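(* Consider the following two assertions about a class of free group homomorphisms: (I) for all homomorphisms $g,h:F(\Sigma)\rightarrow F(\Delta)$ of free groups with $h$ injective, $\operatorname{rk}(\operatorname{Eq}(g,h))\leq|\Sigma|$; (II) for every set $S$ of homomorphisms $F(\Sigma)\rightarrow F(\Delta)$ of free groups containing at least one injective map, $\operatorname{Eq}(S)$ is inert in $F(\Sigma)$. Then: (1) Assertion (I) holds (for all free groups $F(\Sigma),F(\Delta)$ and all such $g,h$) if and only if assertion (II) holds (for all free groups $F(\Sigma),F(\Delta)$ and all such $S$). (2) Assertion (I) holds for injective maps (i.e. for all $F(\Sigma),F(\Delta)$ and all $g,h$ both injective) if and only if assertion (II) holds for injective maps (i.e. for all $F(\Sigma),F(\Delta)$ and all nonempty sets $S$ consisting of injective homomorphisms).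
   Context: $F(\Sigma)$ denotes the free group with basis $\Sigma$, and $\operatorname{rk}$ denotes the rank of a free group. For homomorphisms $g,h:F(\Sigma)\to F(\Delta)$, $\operatorname{Eq}(g,h):=\{x\in F(\Sigma)\mid g(x)=h(x)\}$, and for a set $S$ of such homomorphisms $\operatorname{Eq}(S):=\bigcap_{g,h\in S}\operatorname{Eq}(g,h)$. A subgroup $H$ of a free group $F$ is inert in $F$ if $\operatorname{rk}(H\cap K)\leq\operatorname{rk}(K)$ for all subgroups $K\leq F$. *)

(* Defs.v *)
From HB Require Import structures.
From mathcomp Require Import all_boot.
From mathcomp Require Import all_classical.

Set Implicit Arguments.
Unset Strict Implicit.
Unset Printing Implicit Defensive.

Local Open Scope classical_set_scope.
Local Open Scope card_scope.
Local Open Scope group_scope.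

(* [free_group X] is the free group F(X), realised as the reduced words over the
   letters [X * bool]: the letter [(x, true)] stands for x and [(x, false)] for
   its inverse. There is no finiteness assumption on X. *)
Section FreeGroup.
Variable X : choiceType.
Implicit Types (a b : X * bool) (s t u : seq (X * bool)).

Definition linv a : X * bool := (a.1, ~~ a.2).

Definition reduced s : bool := sorted (fun a b => b != linv a) s.

Definition push a s : seq (X * bool) :=
  if s is b :: t then (if b == linv a then t else a :: s) else [:: a].

Record free_group : predArgType := FreeWord {
  word :> seq (X * bool);
  _ : reduced word
}.

HB.instance Definition _ := [isSub for word].
HB.instance Definition _ := [Choice of free_group by <:].

Lemma linvK : involutive linv.
Proof. by case=> x b; rewrite /linv /= negbK. Qed.

Lemma linv_neq a : (a == linv a) = false.
Proof. by case: a => x []; rewrite /linv xpair_eqE andbF. Qed.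

Lemma linv_eq a b : (a == linv b) = (b == linv a).
Proof. by apply/eqP/eqP=> ->; rewrite linvK. Qed.

Lemma reduced_behead a s : reduced (a :: s) -> reduced s.
Proof. exact: path_sorted. Qed.

Lemma reduced_push a s : reduced s -> reduced (push a s).
Proof.
case: s => [//|b s] rs /=; case: ifP => [_|ab]; first exact: reduced_behead rs.
by rewrite /reduced /= ab.
Qed.

Lemma reduced_foldr s t : reduced t -> reduced (foldr push t s).
Proof. by move=> rt; elim: s => //= a s; apply: reduced_push. Qed.

Lemma push_linv a s : reduced s -> push a (push (linv a) s) = s.
Proof.
case: s => [_|b s rs] /=; first by rewrite eqxx.
rewrite linvK; case: eqP => [<-|_] /=; last by rewrite eqxx.
by case: s rs => //= c s /andP[/negPf-> _].
Qed.

Lemma foldr_push_cons a s t : reduced t ->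
  foldr push t (push a s) = push a (foldr push t s).
Proof.
move=> rt; case: s => //= b s; case: eqP => //= ->.
by rewrite push_linv// reduced_foldr.
Qed.

Lemma foldr_pushA s t u : reduced u ->
  foldr push u (foldr push t s) = foldr push (foldr push u t) s.
Proof. by move=> ru; elim: s => //= a s <-; rewrite foldr_push_cons. Qed.

Lemma foldr_push0 s : reduced s -> foldr push [::] s = s.
Proof.
elim: s => //= a s IH rs; rewrite IH; last exact: reduced_behead rs.
by case: s rs {IH} => //= b s /andP[/negPf-> _].
Qed.

Definition winv s : seq (X * bool) := rev (map linv s).

Lemma reduced_winv s : reduced s -> reduced (winv s).
Proof.
rewrite /reduced /winv rev_sorted sorted_map.
by apply: sub_sorted => a b /=; rewrite linvK eq_sym.
Qed.

Lemma winvK : involutive winv.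
Proof. by move=> s; rewrite /winv map_rev revK mapK//; exact: linvK. Qed.

Lemma foldr_winv s t : reduced t -> foldr push (foldr push t s) (winv s) = t.
Proof.
elim: s t => //= a s IH t rt.
rewrite /winv /= rev_cons foldr_rcons.
have := @push_linv (linv a) (foldr push t s) (reduced_foldr s rt).
by rewrite linvK => ->; exact: IH.
Qed.

Definition fone : free_group := FreeWord (isT : reduced [::]).
Definition fmul (v w : free_group) : free_group :=
  FreeWord (reduced_foldr v (valP w)).
Definition finv (w : free_group) : free_group := FreeWord (reduced_winv (valP w)).

Lemma fmulA : associative fmul.
Proof. by move=> u v w; apply: val_inj; rewrite /= foldr_pushA//; exact: valP w. Qed.

Lemma fmul1 : left_id fone fmul.
Proof. by move=> w; apply: val_inj. Qed.

Lemma fmulr1 : right_id fone fmul.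
Proof. by move=> w; apply: val_inj; rewrite /= foldr_push0//; exact: valP w. Qed.

Lemma fmulV : left_inverse fone finv fmul.
Proof.
move=> w; apply: val_inj => /=; rewrite -[X in foldr _ X _](foldr_push0 (valP w)).
exact: foldr_winv.
Qed.

Lemma fmulrV : right_inverse fone finv fmul.
Proof.
move=> w; rewrite -[X in fmul X _](_ : finv (finv w) = w) ?fmulV//.
by apply: val_inj; rewrite /= winvK.
Qed.

HB.instance Definition _ :=
  isGroup.Build free_group fmulA fmul1 fmulr1 fmulV fmulrV.

Definition fgen (x : X) : free_group :=
  FreeWord (isT : reduced [:: (x, true)]).

End FreeGroup.

(* In the library, group homomorphisms are morphisms of unital magmas. *)
Notation ghom G H := (UMagmaMorphism.type G H).

(* [flift f] is the homomorphism F(X) -> G extending f : X -> G. *)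
Section Lift.
Variables (X : choiceType) (G : groupType) (f : X -> G).

Definition flift_letter (a : X * bool) : G := if a.2 then f a.1 else (f a.1)^-1.

Definition flift (w : free_group X) : G := \prod_(a <- word w) flift_letter a.

Lemma flift_letterV a : flift_letter (linv a) = (flift_letter a)^-1.
Proof. by case: a => x []; rewrite /flift_letter //= invgK. Qed.

Lemma flift_push a s :
  \prod_(b <- push a s) flift_letter b
  = flift_letter a * \prod_(b <- s) flift_letter b.
Proof.
case: s => [|b s]; first by rewrite /= big_seq1 big_nil mulg1.
rewrite /push; case: eqP => [->|_]; last by rewrite big_cons.
by rewrite big_cons flift_letterV mulVKg.
Qed.

Lemma fliftM : {morph flift : v w / v * w}.
Proof.
move=> v w; rewrite /flift /=; elim: (word v) => [|a s IH] /=.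
  by rewrite big_nil mul1g.
by rewrite flift_push IH big_cons mulgA.
Qed.

Lemma fliftF : {morph flift : v w / v / w}.
Proof.
have flift1 : flift 1 = 1 by rewrite /flift big_nil.
move=> v w; rewrite fliftM; congr (_ * _).
by apply: (@mulIg _ (flift w)); rewrite -fliftM !mulVg flift1.
Qed.

HB.instance Definition _ := isGroupMorphism.Build (free_group X) G flift fliftF.

Lemma flift_gen x : flift (fgen x) = f x.
Proof. by rewrite /flift big_seq1. Qed.

End Lift.

Lemma flift_unique (X : choiceType) (G : groupType)
    (g h : ghom (free_group X) G) :
  (forall x, g (fgen x) = h (fgen x)) -> g =1 h.
Proof.
move=> gh [s rs]; elim: s rs => [|a s IH] rs.
  by rewrite (_ : FreeWord rs = 1) ?gmulf1//; apply: val_inj.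
pose l : free_group X := FreeWord (isT : reduced [:: a]).
rewrite (_ : FreeWord rs = l * FreeWord (reduced_behead rs)); last first.
  by apply: val_inj; case: s rs {IH} => //= b s /andP[/negPf->].
rewrite !gmulfM IH; congr (_ * _); rewrite {}/l {IH rs}; case: a => x [].
  exact: gh.
rewrite (_ : FreeWord _ = (fgen x)^-1); first by rewrite !gmulfV gh.
exact: val_inj.
Qed.

Section Subgroups.
Variable G : groupType.
Implicit Types H K B : set G.

Definition is_subgroup H : Prop := group_closed (mem H).

Definition is_basis H B : Prop :=
  injective (flift (val : B -> G)) /\ range (flift (val : B -> G)) = H.

(* Ranks are cardinals, hence only ever compared. Subgroups of free groups have
   bases, all of the same cardinality, so the choice of bases below is
   immaterial. *)
Definition rank_le_card H (T : Type) (A : set T) : Prop :=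
  exists2 B, is_basis H B & B #<= A.

Definition rank_le H K : Prop := exists2 C, is_basis K C & rank_le_card H C.

Definition inert H : Prop :=
  is_subgroup H /\ forall K, is_subgroup K -> rank_le (H `&` K) K.

End Subgroups.

Section Equalisers.
Variables F G : groupType.

Definition equaliser (g h : ghom F G) : set F := [set x | g x = h x].

Definition equaliser_of (S : set (ghom F G)) : set F :=
  \bigcap_(g in S) \bigcap_(h in S) equaliser g h.

End Equalisers.

(* Main.v *)
Require Import Defs.
From HB Require Import structures.
From mathcomp Require Import all_boot fingroup perm finmap.
From mathcomp Require Import all_classical.

Set Implicit Arguments.
Unset Strict Implicit.
Unset Printing Implicit Defensive.

Local Open Scope classical_set_scope.

(** Both assertions compare cardinals of bases, and rank_le_card H A amounts
    to an injective homomorphism from some F(X) onto H with X no larger than A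
    (rank_le_card_range, rank_le_cardP).

    That inertia gives the bound on the equaliser of a pair is the case K =
    F(Sigma), once all bases of a free group are known to have the same
    cardinality (card_basis_le).

    Conversely let h be an injective member of S, and K a subgroup with basis
    C, which exists by Nielsen and Schreier (subgroup_basis). If H is free on
    X, with X no larger than C, then restricting g and h to H gives two
    homomorphisms on F(X), the second one injective, whose equaliser is the
    intersection of H with Eq(g, h). Assertion (I) bounds its rank by |X|,
    hence by |C| (rank_le_cardI_equaliser). Starting from K, one can thus
    impose finitely many of the equations g = h without leaving the subgroups
    of rank at most |C|.

    The intersection L of K with Eq(S) imposes all of them, so a passage to
    the limit is needed. If C is infinite there is nothing to prove: L lies in
    K, which has no more than |C| elements (card_free_group_le, resting on
    card_seq_le). If C is finite, L can be approximated from above: for each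
    finite set of elements outside L, some H as above contains L and avoids
    that set. Suppose that a Schreier basis of L has more than |C| elements.
    Finitely many of these involve only a finite suffix-closed part V of the
    transversal of L. Choose H so close to L that the elements of V remain in
    distinct cosets of H; then V extends to a Schreier transversal of H, and
    the chosen basis elements of L belong to the resulting basis of H, which
    is too many (rank_le_card_approx). Restrictions of injective maps are
    injective, so the same argument serves both parts. *)

(** * Cardinality of the words over an infinite alphabet *)

Lemma card_setTP (A B : Type) :
  ([set: A] #<= [set: B])%card <-> exists f : A -> B, injective f.
Proof.
split=> [/card_leP[f]|[f f_inj]].
  exists (fun a => val (f (to_setT a))) => a a' /val_inj e.
  have := @inj _ _ _ f (to_setT a) (to_setT a') (mem_set I) (mem_set I) e.
  by move=> /(congr1 val).
rewrite -(card_le_eql (inj_card_eq (in2W f_inj))).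
exact: card_leT.
Qed.

(** Zorn's lemma on the graphs of partial injections from [A] to [B]: a
    maximal one is defined everywhere or hits everything. *)
Lemma injective_total (A B : Type) :
  (exists f : A -> B, injective f) \/ (exists g : B -> A, injective g).
Proof.
pose P (R : set (A * B)) :=
  (forall a b b', R (a, b) -> R (a, b') -> b = b') /\
  (forall a a' b, R (a, b) -> R (a', b) -> a = a').
have [F FP Ftot|R [[Rf Ri] Rmax]] := @Zorn_bigcup (A * B)%type P.
  have common u v : (\bigcup_(R in F) R) u -> (\bigcup_(R in F) R) v ->
      exists2 R, F R & R u /\ R v.
    move=> [R FR Ru] [R' FR' R'v].
    by have [/(_ _ Ru)|/(_ _ R'v)] := Ftot _ _ FR FR'; [exists R'|exists R].
  by split=> a b c u v; have [R FR [Ru Rv]] := common _ _ u v;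
    have [Rf Ri] := FP _ FR; [apply: Rf Ru Rv|apply: Ri Ru Rv].
have [dom|/existsNP[a Na]] := pselect (forall a, exists b, R (a, b)).
  left; have [f fP] := choice dom; exists f => a a' e.
  by apply: (Ri _ _ (f a)) => //; rewrite e.
have [cod|/existsNP[b Nb]] := pselect (forall b, exists a, R (a, b)).
  right; have [g gP] := choice cod; exists g => b b' e.
  by apply: (Rf (g b)) => //; rewrite e.
case: (Rmax (R `|` [set (a, b)])).
  split=> [|/(_ (a, b))]; first exact: subsetUl.
  by move=> Rab; apply: Na; exists b; apply: Rab; right.
split=> [x y y'|x x' y] [Rx|[? ?]] [Rx'|[? ?]]; subst=> //.
- exact: Rf Rx Rx'.
- by case: Na; exists y.
- by case: Na; exists y'.
- exact: Ri Rx Rx'.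
- by case: Nb; exists x.
- by case: Nb; exists x'.
Qed.

Section Words.
Variable X : choiceType.

Definition words_in (D : set X) : set (seq X) :=
  [set s | forall x, x \in s -> D x].

(** Words, rather than pairs, because codings can be iterated: words of words
    are coded as well, which leaves codes for further letters. *)
Definition coding (p : set X * (seq X -> X)) : Prop :=
  (forall s, words_in p.1 s -> p.1 (p.2 s)) /\
  (forall s t, words_in p.1 s -> words_in p.1 t -> p.2 s = p.2 t -> s = t).

Definition coding_extends (p q : set X * (seq X -> X)) : Prop :=
  p.1 `<=` q.1 /\ (forall s, words_in p.1 s -> q.2 s = p.2 s).

(** The union of a chain works because the letters of a word, being finitely
    many, already lie in one member of the chain. *)
Lemma coding_sup (C : set (set X * (seq X -> X))) p0 :
  C p0 -> C `<=` coding -> total_on C coding_extends ->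
  exists2 p, coding p & forall q, C q -> coding_extends q p.
Proof.
move=> Cp0 Ccod Ctot; pose D := [set x | exists2 p, C p & p.1 x].
have wordsS p q s : coding_extends p q -> words_in p.1 s -> words_in q.1 s.
  by move=> [pq _] ps x /ps/pq.
have common s : words_in D s -> exists2 p, C p & words_in p.1 s.
  elim: s => [|x s IH] sD; first by exists p0.
  have [|p Cp ps] := IH; first by move=> y ys; apply: sD; rewrite inE ys orbT.
  have [q Cq qx] := sD x (mem_head _ _).
  have [pq|qp] := Ctot _ _ Cp Cq.
    exists q => // y; rewrite inE => /orP[/eqP->//|ys].
    exact: wordsS pq ps _ ys.
  exists p => // y; rewrite inE => /orP[/eqP->|/ps//].
  exact: qp.1 _ qx.
pose val_at s := [set y | exists2 p, C p & words_in p.1 s /\ p.2 s = y].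
pose f s := xget (p0.2 s) (val_at s).
have fE p s : C p -> words_in p.1 s -> f s = p.2 s.
  move=> Cp ps; apply: xget_unique => [|y [q Cq [qs <-]]]; first by exists p.
  by have [[_ ->]|[_ ->]] := Ctot _ _ Cp Cq.
exists (D, f); last first.
  by move=> q Cq; split=> [x qx|s qs] /=; [exists q|exact: fE].
split=> [s /common[p Cp ps]|s t sD tD] /=.
  by exists p => //; rewrite (fE p)//; apply: (Ccod _ Cp).1.
have [p Cp pst] : exists2 p, C p & words_in p.1 (s ++ t).
  by apply: common => x; rewrite mem_cat => /orP[/sD|/tD].
have ps : words_in p.1 s by move=> x xs; apply: pst; rewrite mem_cat xs.
have pt : words_in p.1 t by move=> x xt; apply: pst; rewrite mem_cat xt orbT.
by rewrite !(fE p)//; apply: (Ccod _ Cp).2.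
Qed.

(** Letters of [D] are treated as words of length one, which leaves the
    two-letter words [g x, g x] free to stand for the letters outside [D]. *)
Lemma coding_enlarge (p : set X * (seq X -> X)) (E : set X) (g : X -> X) :
  coding p ->
  (forall x, E x -> ~ p.1 x -> p.1 (g x)) ->
  (forall x y, E x -> E y -> ~ p.1 x -> ~ p.1 y -> g x = g y -> x = y) ->
  exists f : seq X -> X, (forall s, words_in E s -> p.1 (f s)) /\
    (forall s t, words_in E s -> words_in E t -> f s = f t -> s = t).
Proof.
case: p => D c [/= cD c_inj] gD g_inj.
pose w x := if `[< D x >] then [:: x] else [:: g x; g x].
have wD x : E x -> words_in D (w x).
  rewrite /w; case: asboolP => Dx Ex y; first by rewrite inE => /eqP->.
  by rewrite !inE => /orP[] /eqP ->; exact: gD.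
have w_inj x y : E x -> E y -> w x = w y -> x = y.
  move=> Ex Ey; rewrite /w; do 2![case: asboolP => ?] => // -[] //.
  by move=> e _; apply: g_inj.
have lettersD s : words_in E s -> words_in D (map (c \o w) s).
  by move=> sE y /mapP[x /sE Ex ->]; apply/cD/wD.
exists (fun s => c (map (c \o w) s)); split=> [s sE|s t sE tE].
  exact/cD/lettersD.
move=> /c_inj-/(_ (lettersD _ sE) (lettersD _ tE)).
elim: s t sE tE => [|x s IH] [|y t]//= sE tE [].
have [Ex Ey] : E x /\ E y by split; [apply: sE|apply: tE]; rewrite mem_head.
move=> /c_inj-/(_ (wD _ Ex) (wD _ Ey))/w_inj-/(_ Ex Ey) -> st.
congr (_ :: _); apply: IH => // z zs; [apply: sE|apply: tE];
  by rewrite inE zs orbT.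
Qed.

(** A coding on some [D] exists because [X] contains a copy of the natural
    numbers; take a maximal one. Unless the complement of [D] injects into
    [D], so that [coding_enlarge] codes all words, that complement contains a
    copy of [D], which receives the codes of the new words and contradicts
    maximality. *)
Lemma card_seq_le : infinite_set [set: X] ->
  ([set: seq X] #<= [set: X])%card.
Proof.
move=> /infiniteP/card_setTP[nu nu_inj].
pose T := {p | coding p}.
pose nat_code (s : seq X) : nat :=
  choice.pickle (map (fun x => xget 0%N [set n | nu n = x]) s).
have cod0 : coding (range nu, nu \o nat_code).
  split=> [s _|s t sR tR] /=; first by exists (nat_code s).
  move=> /nu_inj/(pcan_inj choice.pickleK).
  have nuK x : range nu x -> nu (xget 0%N [set n | nu n = x]) = x.
    by move=> [n _ <-]; rewrite (xget_unique _ (x := n))// => m /nu_inj.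
  elim: s t sR tR => [|x s IH] [|y t]//= sR tR [].
  move=> /(congr1 nu); rewrite !nuK; last 2 first.
  - by apply: tR; rewrite mem_head.
  - by apply: sR; rewrite mem_head.
  move=> -> st; congr (_ :: _); apply: IH => // z zs; [apply: sR|apply: tR];
    by rewrite inE zs orbT.
pose R (p q : T) : bool := `[< coding_extends (sval p) (sval q) >].
have [|||] := @ZL_preorder T (exist _ _ cod0) R.
- by move=> p; apply/asboolP; split.
- move=> q p r /asboolP[qp qpE] /asboolP[pr prE]; apply/asboolP.
  split=> [x /qp/pr//|s qs]; rewrite prE ?qpE// => x /qs; exact: qp.
- move=> A Atot; have [[p Ap]|A0] := pselect (exists p, A p); last first.
    by exists (exist _ _ cod0) => q Aq; case: A0; exists q.
  have [|||q q_cod qP] := @coding_sup [set sval p | p in A] (sval p).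
  + by exists p.
  + by move=> _ [r _ <-]; exact: svalP.
  + move=> _ _ [r Ar <-] [r' Ar' <-].
    by have [/asboolP|/asboolP] := Atot _ _ Ar Ar'; [left|right].
  by exists (exist _ _ q_cod) => r Ar; apply/asboolP/qP; exists r.
move=> [p p_cod] p_max.
have [[g g_inj]|[h h_inj]] := injective_total {x | ~ p.1 x} {x | p.1 x}.
  pose g' x :=
    if pselect (p.1 x) is right Nx then sval (g (exist _ x Nx)) else x.
  have [||f [_ f_inj]] := @coding_enlarge p setT g' p_cod.
  - by move=> x _ Nx; rewrite /g'; case: pselect => // Nx'; exact: svalP.
  - move=> x y _ _ Nx Ny; rewrite /g'; do 2![case: pselect => // ?].
    by move=> /eq_sig_hprop-/(_ (fun=> @Prop_irrelevance _))/g_inj[].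
  by apply/card_setTP; exists f => s t; exact: f_inj.
pose h' x := if pselect (p.1 x) is left Dx then sval (h (exist _ x Dx)) else x.
have h'N x : p.1 x -> ~ p.1 (h' x).
  by move=> Dx; rewrite /h'; case: pselect => // Dx'; exact: (svalP (h _)).
have h'_inj x y : p.1 x -> p.1 y -> h' x = h' y -> x = y.
  move=> Dx Dy; rewrite /h'; do 2![case: pselect => // ?].
  by move=> /eq_sig_hprop-/(_ (fun=> @Prop_irrelevance _))/h_inj[].
pose E := p.1 `|` h' @` p.1.
pose g y := xget y [set x | p.1 x /\ h' x = y].
have gK x : p.1 x -> g (h' x) = x.
  by move=> Dx; apply: xget_unique => // y [Dy /h'_inj]; apply.
have [||f [fD f_inj]] := @coding_enlarge p E g p_cod.
- by move=> _ [//|[x Dx <-]] _; rewrite gK.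
- by move=> _ _ [//|[x Dx <-]] [//|[y Dy <-]] _ _; rewrite !gK// => ->.
case: (p_cod) => cD c_inj.
pose c s := if `[< words_in p.1 s >] then p.2 s else h' (f s).
have c_cod : coding (E, c).
  split=> [s Es|s t Es Et] /=; rewrite /c.
    case: asboolP => Ds; first by left; exact: cD.
    by right; exists (f s); first exact: fD.
  do 2![case: asboolP => ?].
  - exact: c_inj.
  - by move=> e; case: (h'N (f t)); [exact: fD|rewrite -e; exact: cD].
  - by move=> e; case: (h'N (f s)); [exact: fD|rewrite e; exact: cD].
  - by move=> /h'_inj-/(_ (fD _ Es) (fD _ Et)); exact: f_inj.
have /asboolP[/= ED _] : R (exist _ _ c_cod) (exist _ _ p_cod).
  apply: p_max; apply/asboolP; split=> [x|s Ds] /=; first by left.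
  by rewrite /c asboolT.
have D0 : p.1 (p.2 [::]) by exact: cD.
by case: (h'N _ D0); apply: ED; right; exists (p.2 [::]).
Qed.

End Words.

(** Signed letters are coded by words of length one or two, so that reduced
    words become words of words. *)
Lemma card_free_group_le (X : choiceType) : infinite_set [set: X] ->
  ([set: free_group X] #<= [set: X])%card.
Proof.
move=> /card_seq_le/card_setTP[c c_inj].
pose letter (a : X * bool) := c (if a.2 then [:: a.1] else [:: a.1; a.1]).
have letter_inj : injective letter.
  by move=> [x []] [y []] /c_inj//= => -[->].
apply/card_setTP; exists (fun w => c (map letter (word w))).
by move=> v w /c_inj/(inj_map letter_inj)/val_inj.
Qed.

(** * Homomorphisms from free groups, and the rank *)

Section Homs.
Variable X : choiceType.

Definition fletter (a : X * bool) : free_group X :=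
  FreeWord (isT : reduced [:: a]).

Lemma fletterE x b :
  fletter (x, b) = (if b then fgen x else (fgen x)^-1)%g.
Proof. by case: b; apply: val_inj. Qed.

Lemma fletterV a : fletter (linv a) = ((fletter a)^-1)%g.
Proof. exact: val_inj. Qed.

Lemma word_fletterM a w : word (fletter a * w)%g = push a (word w).
Proof. by []. Qed.

Lemma FreeWord_cons a s (rs : reduced (a :: s)) :
  FreeWord rs = (fletter a * FreeWord (reduced_behead rs))%g.
Proof.
by apply: val_inj; case: s rs => //= b s /andP[/negPf->].
Qed.

Lemma free_group_ind (P : free_group X -> Prop) :
  P 1%g -> (forall a w, P w -> P (fletter a * w)%g) -> forall w, P w.
Proof.
move=> P1 PM [s rs]; elim: s rs => [|a s IH] rs.
  by rewrite (_ : FreeWord rs = 1%g)//; apply: val_inj.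
by rewrite FreeWord_cons; apply: PM.
Qed.

End Homs.

Lemma flift_fletterM (X : choiceType) (G : groupType) (f : X -> G) a w :
  flift f (fletter a * w)%g = (flift_letter f a * flift f w)%g.
Proof. by rewrite gmulfM; congr (_ * _)%g; apply: big_seq1. Qed.

Section Subgroups.
Variables (G : groupType).
Implicit Types (H K : set G).

Lemma is_subgroupP H : is_subgroup H <->
  H 1%g /\ (forall x y, H x -> H y -> H (x * y)%g) /\
  (forall x, H x -> H (x^-1)%g).
Proof.
split=> [HG|[H1 [HM HV]]].
  split; first by have := HG.1; rewrite inE.
  split=> [x y Hx Hy|x Hx].
    by apply: set_mem; apply: (group_closedM HG); apply: mem_set.
  by apply: set_mem; apply: (group_closedV HG); apply: mem_set.
split=> [|x y /set_mem Hx /set_mem Hy]; first exact: mem_set.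
by apply: mem_set; apply: HM => //; exact: HV.
Qed.

Lemma is_subgroupI H K : is_subgroup H -> is_subgroup K ->
  is_subgroup (H `&` K).
Proof.
move=> /is_subgroupP[H1 [HM HV]] /is_subgroupP[K1 [KM KV]].
apply/is_subgroupP; split=> //; split=> [x y [? ?] [? ?]|x [? ?]].
  by split; [exact: HM|exact: KM].
by split; [exact: HV|exact: KV].
Qed.

Lemma is_subgroup_flift (X : choiceType) (f : X -> G) H : is_subgroup H ->
  (forall x, H (f x)) -> forall w, H (flift f w).
Proof.
move=> /is_subgroupP[H1 [HM HV]] Hf; apply: free_group_ind.
  by rewrite gmulf1.
move=> [x b] w Hw; rewrite flift_fletterM; apply: HM => //.
by case: b; [exact: Hf|exact: HV (f x) (Hf x)].
Qed.

Lemma is_subgroup_equaliser (F : groupType) (g h : ghom G F) :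
  is_subgroup (equaliser g h).
Proof.
apply/is_subgroupP; rewrite /equaliser /=; split; first by rewrite !gmulf1.
by split=> [x y e e'|x e]; rewrite ?gmulfM ?gmulfV ?e ?e'.
Qed.

(** Injectivity of [phi] on the generators lets the free group on the image
    set replace [free_group X]. *)
Lemma rank_le_card_range (X : choiceType) (phi : ghom (free_group X) G)
    (U : Type) (A : set U) :
  injective phi -> ([set: X] #<= A)%card -> rank_le_card (range phi) A.
Proof.
move=> phi_inj XA; pose B : set G := range (phi \o @fgen X).
have Bgen x : B (phi (fgen x)) by exists x.
pose gen x : B := exist _ (phi (fgen x)) (mem_set (Bgen x)).
pose ren := flift (fun x => fgen (gen x)).
have flift_ren w : flift (val : B -> G) (ren w) = phi w.
  pose L : ghom (free_group X) G := flift (val : B -> G) \o ren.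
  by apply: (@flift_unique _ _ L phi) => x; rewrite /L /= /ren !flift_gen.
have ren_surj v : exists w, ren w = v.
  elim/free_group_ind: v => [|[[y By] b] v [w <-]].
    by exists 1%g; rewrite /ren gmulf1.
  have /set_mem[x _ xy] := By.
  exists (fletter (x, b) * w)%g; rewrite /ren flift_fletterM; congr (_ * _)%g.
  have e : gen x = exist _ y By by apply: val_inj.
  by rewrite fletterE /flift_letter /= e.
exists B; first split.
- move=> v v'; have [w <-] := ren_surj v; have [w' <-] := ren_surj v'.
  by rewrite !flift_ren => /phi_inj->.
- apply/seteqP; split=> [_ [v _ <-]|_ [w _ <-]].
    by have [w <-] := ren_surj v; rewrite flift_ren; exists w.
  by exists (ren w) => //; exact: flift_ren.
- by apply: card_le_trans XA; exact: card_image_le.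
Qed.

(** Passing to an abstract [X] avoids carrying subsets of groups along when
    homomorphisms are composed. *)
Lemma rank_le_cardP H (U : Type) (A : set U) :
  rank_le_card H A -> exists (X : choiceType) (phi : ghom (free_group X) G),
    [/\ injective phi, range phi = H & ([set: X] #<= A)%card].
Proof.
move=> [B [B_inj BH] BA]; exists B, (flift (val : B -> G)); split=> //.
by rewrite (card_le_eql (card_setT B)).
Qed.

End Subgroups.

(** A surjection embeds the homomorphisms from F(Y) into those from F(X). For
    finite [X], counting homomorphisms to a group of order two settles the
    matter; if [X] is infinite, F(X) itself is no larger than [X]. *)
Lemma card_le_surj_hom (X Y : choiceType)
    (theta : ghom (free_group X) (free_group Y)) :
  (forall v, exists w, theta w = v) -> ([set: Y] #<= [set: X])%card.
Proof.
move=> theta_surj.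
have [Xfin|Xinf] := pselect (finite_set [set: X]); last first.
  apply: card_le_trans (card_free_group_le Xinf).
  have [s sK] := choice theta_surj.
  apply/card_setTP; exists (s \o @fgen Y) => y y' /(congr1 theta).
  by rewrite /= !sK => -[].
have [n Xn] := Xfin; apply: contrapT => YX.
have [e e_inj] : exists e : 'I_n.+1 -> Y, injective e.
  apply/card_setTP; rewrite -(card_le_eql card_II).
  have [[m Ym]|/infiniteP Yinf] := pselect (finite_set [set: Y]); last first.
    by apply: card_le_trans Yinf; exact: card_leT.
  rewrite (card_le_eqr Ym) card_le_II ltnNge; apply/negP => mn; apply: YX.
  by rewrite (card_le_eql Ym) (card_le_eqr Xn) card_le_II.
have [x x_surj] : exists x : 'I_n -> X, forall z, exists j, x j = z.
  have /card_bijP[f [f' fK f'K]] : ([set: X] #= [set: 'I_n])%card.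
    by rewrite -(card_eqr card_II).
  exists (fun j => val (f' (to_setT j))) => z; exists (val (f (to_setT z))).
  rewrite (_ : to_setT _ = f (to_setT z)) ?fK//; exact: val_inj.
(* The function [u] on n.+1 of the generators of F(Y), extended by 1 to the
   others, determines a homomorphism, which is recovered from its values at
   the images of the n generators of F(X). *)
pose val_at (u : {ffun 'I_n.+1 -> {perm bool}}) y : {perm bool} :=
  if [pick i | e i == y] is Some i then u i else 1%g.
pose Phi u : {ffun 'I_n -> {perm bool}} :=
  [ffun j => flift (val_at u) (theta (fgen (x j)))].
have Phi_inj : injective Phi.
  move=> u u' /ffunP uu'; apply/ffunP => i.
  have eq_flift : flift (val_at u) =1 flift (val_at u').
    move=> v; have [w <-] := theta_surj v.
    pose L u : ghom (free_group X) {perm bool} := flift (val_at u) \o theta.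
    apply: (@flift_unique _ _ (L u) (L u')) => z; have [j <-] := x_surj z.
    by have := uu' j; rewrite !ffunE.
  have := eq_flift (fgen (e i)); rewrite !flift_gen /val_at.
  by case: pickP => [j /eqP/e_inj->|/(_ i)/[!eqxx]].
have perm_bool_gt1 : (1 < #|{perm bool}|)%N.
  apply/card_gt1P; exists 1%g, (tperm false true); split=> //.
  by apply/eqP => /permP/(_ false); rewrite perm1 tpermL.
have := leq_card Phi Phi_inj.
by rewrite !card_ffun !card_ord leq_exp2l// ltnn.
Qed.

(** Writing each generator on one side as a word in the generators of the
    other gives a surjection between the two free groups. *)
Lemma card_basis_le (G : groupType) (X Y : choiceType)
    (phi : ghom (free_group X) G) (psi : ghom (free_group Y) G) :
  injective psi -> range psi = range phi -> ([set: Y] #<= [set: X])%card.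
Proof.
move=> psi_inj psi_phi.
have /choice[w wP] x : exists w, psi w = phi (fgen x).
  have : range psi (phi (fgen x)) by rewrite psi_phi; exists (fgen x).
  by move=> [w _ <-]; exists w.
apply: (@card_le_surj_hom X Y (flift w)) => v.
have : range phi (psi v) by rewrite -psi_phi; exists v.
move=> [u _ uv]; exists u; apply: psi_inj; rewrite -uv.
pose L : ghom (free_group X) G := psi \o flift w.
by apply: (@flift_unique _ _ L phi) => x; rewrite /L /= flift_gen.
Qed.

(** * Schreier bases *)

Section Schreier.
Variable X : choiceType.
Local Notation F := (free_group X).
Implicit Types (H T : set F) (g h t u v w : F).

(** Multiplication of reduced words acts on their first letters, so left
    cosets and transversals closed under suffixes are used here, where most
    texts take right cosets and prefixes. *)
Definition suffix_closed T : Prop :=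
  forall v w, suffix (word v) (word w) -> T w -> T v.

Definition separated H T : Prop :=
  forall t u, T t -> T u -> H (t^-1 * u)%g -> t = u.

Definition schreier_transversal H T : Prop :=
  [/\ suffix_closed T, separated H T
    & forall g, exists2 t, T t & H (t^-1 * g)%g].

Definition schreier_gens H T : set F :=
  [set b | [/\ H b, b != 1%g &
    exists x t u, [/\ T t, T u & b = (u^-1 * (fgen x * t))%g]]].

(** A maximal suffix-closed separated set meets every coset. Otherwise some
    letter [a] leads from the coset of an element [t] of the set to a coset
    that it misses. No cancellation occurs in [a t], since [a t] would then be
    a suffix of [t], so [a t] can be added. *)
Lemma schreier_transversal_ext H T0 :
  is_subgroup H -> T0 1%g -> suffix_closed T0 -> separated H T0 ->
  exists2 T, schreier_transversal H T & T0 `<=` T.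
Proof.
move=> /is_subgroupP[H1 [HM HV]] T01 T0suf T0sep.
pose P T := suffix_closed (T0 `|` T) /\ separated H (T0 `|` T).
have P0 : P set0 by rewrite /P setU0.
have [C CP Ctot|T [[Tsuf Tsep] Tmax]] := @Zorn_bigcup F P.
  split=> [v w vw [T0w|[T CT Tw]]|t u Ct Cu].
  - by left; exact: T0suf vw T0w.
  - have [Tsuf _] := CP _ CT.
    by case: (Tsuf v w vw (or_intror Tw)) => ?; [left|right; exists T].
  have [T [_ Tsep] [Tt Tu]] : exists2 T, P T & (T0 `|` T) t /\ (T0 `|` T) u.
    case: Ct Cu => [T0t|[R CR Rt]] [T0u|[R' CR' R'u]].
    - by exists set0 => //; split; left.
    - by exists R'; [exact: CP|split; [left|right]].
    - by exists R; [exact: CP|split; [right|left]].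
    - have [RR'|R'R] := Ctot _ _ CR CR'.
        by exists R'; [exact: CP|split; right=> //; exact: RR'].
      by exists R; [exact: CP|split; right=> //; exact: R'R].
  exact: Tsep.
exists (T0 `|` T); last exact: subsetUl.
split=> //; elim/free_group_ind => [|a w [t Tt tw]].
  by exists 1%g; [left|rewrite mulg1 invg1].
have [[u Tu ut]|Nrep] :=
  pselect (exists2 u, (T0 `|` T) u & H (u^-1 * (fletter a * t))%g).
  exists u => //.
  rewrite (_ : _ * _ = (u^-1 * (fletter a * t)) * (t^-1 * w))%g.
    exact: HM.
  by rewrite -!mulgA mulVKg.
have at_word : word (fletter a * t)%g = a :: word t.
  rewrite word_fletterM /push; case et: (word t) => [|b s]//.
  case: eqP => // ba; case: Nrep; exists (fletter a * t)%g; last first.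
    by rewrite mulVg.
  apply: Tsuf Tt; rewrite word_fletterM et /= ba eqxx.
  exact: suffix_cons.
case: (Tmax (T `|` [set (fletter a * t)%g])).
  split=> [|sub]; first exact: subsetUl.
  case: Nrep; exists (fletter a * t)%g; last by rewrite mulVg.
  by right; apply: sub; right.
rewrite /P setUA; split.
  move=> v u vu [Tu|ue]; first by left; exact: Tsuf vu Tu.
  move: vu; rewrite ue at_word => /suffixP[[|b p] /= vt].
    by right; apply: val_inj; exact: etrans (esym vt) (esym at_word).
  left; apply: Tsuf Tt; case: vt => _ ->; exact: suffix_suffix.
have Hsym u v : H (u^-1 * v)%g -> H (v^-1 * u)%g.
  by move=> /HV; rewrite invgM invgK.
move=> u v [Tu|->] [Tv|->] //; first exact: Tsep.
  by move=> ?; case: Nrep; exists u.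
by move=> /Hsym ?; case: Nrep; exists v.
Qed.

Section Basis.
Variables H T : set F.
Hypotheses (H_subgroup : is_subgroup H).
Hypotheses (T_transversal : schreier_transversal H T).

Let H1 : H 1%g. Proof. by case/is_subgroupP: H_subgroup. Qed.
Let HM x y : H x -> H y -> H (x * y)%g.
Proof. by case/is_subgroupP: H_subgroup => _ [HM _]; exact: HM. Qed.
Let HV x : H x -> H (x^-1)%g.
Proof. by case/is_subgroupP: H_subgroup => _ [_ HV]; exact: HV. Qed.

Let T_suffix : suffix_closed T. Proof. by case: T_transversal. Qed.

Definition coset_rep g : F := xget 1%g [set t | T t /\ H (t^-1 * g)%g].

Lemma coset_repP g : T (coset_rep g) /\ H ((coset_rep g)^-1 * g)%g.
Proof.
apply: (@xgetPex _ 1%g [set t | T t /\ H (t^-1 * g)%g]).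
by case: T_transversal => _ _ /(_ g)[t Tt tg]; exists t.
Qed.

Lemma coset_repE t g : T t -> H (t^-1 * g)%g -> coset_rep g = t.
Proof.
move=> Tt tg; have [Tr rg] := coset_repP g.
case: T_transversal => _ Tsep _; apply: Tsep => //.
by have := HM rg (HV tg); rewrite invgM invgK mulgA mulgK.
Qed.

Lemma coset_rep_id t : T t -> coset_rep t = t.
Proof. by move=> Tt; apply: coset_repE; rewrite ?mulVg. Qed.

Lemma transversal1 : T 1%g.
Proof. by apply: T_suffix (coset_repP 1%g).1; exact: suffix0s. Qed.

Lemma coset_rep_mulr g h : H h -> coset_rep (g * h)%g = coset_rep g.
Proof.
move=> Hh; apply: coset_repE; first exact: (coset_repP g).1.
by rewrite mulgA; apply: HM => //; exact: (coset_repP g).2.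
Qed.

Definition edge x g : F :=
  ((coset_rep (fgen x * g))^-1 * (fgen x * coset_rep g))%g.

Lemma edge_mulr x g h : H h -> edge x (g * h)%g = edge x g.
Proof. by move=> Hh; rewrite /edge (mulgA (fgen x)) !(coset_rep_mulr _ Hh). Qed.

Lemma edge_subgroup x g : H (edge x g).
Proof.
have := HM (coset_repP (fgen x * g)%g).2 (HV (coset_repP g).2).
by rewrite invgM invgK -!mulgA mulVKg.
Qed.

Local Notation B := (schreier_gens H T).

Lemma edge_gens x g : edge x g != 1%g -> B (edge x g).
Proof.
move=> e1; split=> //; first exact: edge_subgroup.
exists x, (coset_rep g), (coset_rep (fgen x * g)%g).
by split=> //; exact: (coset_repP _).1.
Qed.

Definition symbol b : free_group B :=
  if insub b is Some c then fgen c else 1%g.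

Lemma symbol_val (c : B) : symbol (val c) = fgen c.
Proof. by rewrite /symbol valK. Qed.

Lemma symbol1 : symbol 1%g = 1%g.
Proof.
rewrite /symbol; case: insubP => // c /set_mem[_ /eqP + _] ce.
by [].
Qed.

Lemma flift_symbol x g : flift (val : B -> F) (symbol (edge x g)) = edge x g.
Proof.
have [e1|/edge_gens/mem_set Be] := eqVneq (edge x g) 1%g.
  by rewrite e1 symbol1 gmulf1.
by rewrite /symbol insubT flift_gen.
Qed.

(** Reidemeister-Schreier rewriting, which inverts the homomorphism from F(B)
    to F: a word is read letter by letter in the coset graph, and each edge
    contributes its basis element, or 1 when it belongs to the tree given by
    the transversal. The edge of an inverse letter is that of the letter,
    traversed backwards. *)
Definition label (a : X * bool) g : free_group B :=
  if a.2 then symbol (edge a.1 g)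
  else ((symbol (edge a.1 (fletter a * g)))^-1)%g.

Lemma label_mulr a g h : H h -> label a (g * h)%g = label a g.
Proof.
by move=> Hh; rewrite /label (mulgA (fletter a)) !(edge_mulr _ _ Hh).
Qed.

Lemma label_transversal a w : T w -> T (fletter a * w)%g -> label a w = 1%g.
Proof.
case: a => x b Tw Taw; rewrite /label /edge /=; move: Taw; rewrite fletterE.
case: b => Taw; last rewrite mulVKg.
  by rewrite !coset_rep_id// mulVg symbol1.
by rewrite !coset_rep_id// mulVKg mulVg symbol1 invg1.
Qed.

Lemma flift_label a w :
  (coset_rep (fletter a * w) * flift (val : B -> F) (label a w)
   = fletter a * coset_rep w)%g.
Proof.
case: a => x []; rewrite /label /=.
  by rewrite flift_symbol /edge mulVKg.
rewrite (_ : flift _ _ = (edge x (fletter (x, false) * w))^-1)%g; last first.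
  by apply: etrans (gmulfV _ _) _; congr (_^-1)%g; exact: flift_symbol.
by rewrite /edge fletterE !invgM invgK mulVKg -!mulgA mulVKg.
Qed.

(** The group element is carried along with the record, so that a step is
    invertible and cancelling letters undo each other. *)
Definition step a (p : F * free_group B) : F * free_group B :=
  (fletter a * p.1, label a p.1 * p.2)%g.

Lemma stepK a p : step a (step (linv a) p) = p.
Proof.
case: p => g v; rewrite /step /= fletterV mulVKg; congr (_, _).
case: a => x []; rewrite /label /= fletterE /=.
  by rewrite mulVKg.
by rewrite invgK mulKg mulKg.
Qed.

Definition trace w : F * free_group B := foldr step (1, 1)%g (word w).
Definition rewriting w : free_group B := (trace w).2.

Lemma trace_fletterM a w : trace (fletter a * w)%g = step a (trace w).
Proof.
rewrite /trace word_fletterM; case: (word w) => //= b s.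
by case: eqP => // ->; rewrite stepK.
Qed.

Lemma trace1 w : (trace w).1 = w.
Proof.
by elim/free_group_ind: w => // a w IH; rewrite trace_fletterM /= IH.
Qed.

Lemma rewriting_fletterM a w :
  rewriting (fletter a * w)%g = (label a w * rewriting w)%g.
Proof. by rewrite /rewriting trace_fletterM /= trace1. Qed.

(** Labels depend only on the left coset of [H], hence rewriting is a
    homomorphism on [H]. *)
Lemma rewriting_mulr g h : H h ->
  rewriting (g * h)%g = (rewriting g * rewriting h)%g.
Proof.
move=> Hh; elim/free_group_ind: g => [|a g IH]; first by rewrite !mul1g.
by rewrite -mulgA !rewriting_fletterM (label_mulr _ _ Hh) IH mulgA.
Qed.

(** Reading a representative only follows edges of the tree. *)
Lemma rewriting_transversal t : T t -> rewriting t = 1%g.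
Proof.
case: t => s rs; elim: s rs => [|a s IH] rs Tt //.
have Ts : T (FreeWord (reduced_behead rs)).
  by apply: T_suffix Tt; exact: suffix_cons.
rewrite FreeWord_cons rewriting_fletterM IH// mulg1 label_transversal//.
by rewrite -FreeWord_cons.
Qed.

Lemma rewriting_gens (b : B) : rewriting (val b) = fgen b.
Proof.
have /set_mem[Hb _ [x [t [u [Tt Tu be]]]]] := valP b.
have repu : coset_rep (fgen x * t)%g = u.
  by apply: coset_repE => //; rewrite -be.
have := rewriting_mulr u Hb; rewrite (rewriting_transversal Tu) mul1g => <-.
rewrite be mulVKg -[fgen x]/(fletter (x, true)) rewriting_fletterM.
rewrite (rewriting_transversal Tt) mulg1 /label /= /edge repu.
by rewrite (coset_rep_id Tt) -be symbol_val.
Qed.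

Lemma flift_gens_subgroup (v : free_group B) : H (flift (val : B -> F) v).
Proof.
by apply: is_subgroup_flift => // -[b /= /set_mem[]].
Qed.

Lemma rewriting_flift (v : free_group B) :
  rewriting (flift (val : B -> F) v) = v.
Proof.
elim/free_group_ind: v => [|[b e] v IH]; first by rewrite gmulf1.
rewrite flift_fletterM rewriting_mulr ?IH; last exact: flift_gens_subgroup.
congr (_ * _)%g; rewrite fletterE /flift_letter /=; case: e.
  exact: rewriting_gens.
have /set_mem[Hb _ _] := valP b.
apply: (@mulIg _ (fgen b)); rewrite mulVg -[in LHS](rewriting_gens b).
by rewrite -rewriting_mulr// mulVg.
Qed.

(** On [H] the representative is 1, so rewriting is also a right inverse of
    the homomorphism from F(B). *)
Lemma flift_rewriting g :
  (coset_rep g * flift (val : B -> F) (rewriting g))%g = g.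
Proof.
elim/free_group_ind: g => [|a w IH].
  by rewrite gmulf1 mulg1 coset_rep_id//; exact: transversal1.
by rewrite rewriting_fletterM gmulfM mulgA flift_label -mulgA IH.
Qed.

Lemma schreier_basis : is_basis H B.
Proof.
split; first exact: can_inj rewriting_flift.
apply/seteqP; split=> [_ [v _ <-]|h Hh]; first exact: flift_gens_subgroup.
exists (rewriting h) => //; have := flift_rewriting h.
by rewrite (@coset_repE 1%g h) ?mul1g ?invg1 ?mul1g//; exact: transversal1.
Qed.

End Basis.

Lemma schreier_transversal_exists H :
  is_subgroup H -> exists T, schreier_transversal H T.
Proof.
move=> HG; have [|||T T_tr _] := @schreier_transversal_ext H [set 1%g] HG.
- by [].
- move=> v w vw w1; move: vw; rewrite w1 suffixs0 => /eqP v1.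
  exact: val_inj.
- by move=> t u -> ->.
by exists T.
Qed.

Lemma subgroup_basis H : is_subgroup H -> exists C, is_basis H C.
Proof.
move=> HG; have [T T_tr] := schreier_transversal_exists HG.
by exists (schreier_gens H T); exact: schreier_basis.
Qed.

End Schreier.

(** * Approximating a subgroup from above *)

Section Approximation.
Variable X : choiceType.
Local Notation F := (free_group X).
Implicit Types (H L T : set F) (t v : F) (V W : seq F).

Lemma suffix_seq t : exists W, forall v, (v \in W) = suffix (word v) (word t).
Proof.
case: t => s rs; elim: s rs => [|a s IH] rs.
  by exists [:: 1%g] => v; rewrite inE /= suffixs0.
have [W WP] := IH (reduced_behead rs).
exists (FreeWord rs :: W) => v; rewrite inE WP /=.
apply/orP/suffixP => [[/eqP->|/suffixP[p ->]]|[[|b p] e]].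
- by exists [::].
- by exists (a :: p).
- by left; apply/eqP/val_inj; exact: esym e.
- by right; case: e => _ ->; exact: suffix_suffix.
Qed.

(** Only the suffixes of the representatives occurring in the elements of [W]
    are needed. *)
Lemma schreier_gens_finite L T W : T 1%g -> suffix_closed T ->
  [set` W] `<=` schreier_gens L T ->
  exists V, [/\ [set` V] `<=` T, [set` V] 1%g, suffix_closed [set` V]
    & [set` W] `<=` schreier_gens L [set` V]].
Proof.
move=> T1 Tsuf; elim: W => [|b W IH] WB.
  exists [:: 1%g]; split=> //.
  - by move=> v; rewrite /= inE => /eqP->.
  - move=> v w vw; rewrite /= !inE => /eqP w1; move: vw.
    by rewrite w1 suffixs0 => /eqP v1; apply/eqP/val_inj.
have [|V [VT V1 Vsuf WV]] := IH.
  by move=> c cW; apply: WB; rewrite /= inE [c \in W]cW orbT.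
have [|Lb b1 [x [t [u [Tt Tu be]]]]] := WB b; first by rewrite /= inE eqxx.
have [Vt VtP] := suffix_seq t; have [Vu VuP] := suffix_seq u.
exists (Vt ++ Vu ++ V); split.
- move=> v; rewrite /= !mem_cat VtP VuP => /or3P[vt|vu|/VT//].
    exact: Tsuf vt Tt.
  exact: Tsuf vu Tu.
- by rewrite /= !mem_cat [1%g \in V]V1 !orbT.
- move=> v w vw; rewrite /= !mem_cat !VtP !VuP => /or3P[wt|wu|wV].
  + by rewrite (suffix_trans vw wt).
  + by rewrite (suffix_trans vw wu) orbT.
  + by rewrite [v \in V](Vsuf _ _ vw wV) !orbT.
- move=> c; rewrite /= inE => /orP[/eqP->|cW].
    split=> //; exists x, t, u; split=> //; rewrite /= !mem_cat VtP VuP.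
      by rewrite suffix_refl.
    by rewrite suffix_refl orbT.
  have [Lc c1 [y [r [q [Vr Vq ce]]]]] := WV _ cW.
  split=> //; exists y, r, q; split=> //; rewrite /= !mem_cat.
    by rewrite [r \in V]Vr !orbT.
  by rewrite [q \in V]Vq !orbT.
Qed.

(** More than [C] elements of a Schreier basis of [L] involve only finitely
    many representatives. A larger subgroup that keeps the cosets of these
    apart has a Schreier transversal containing them, so the same elements
    belong to a basis of it, which contradicts the bound on its rank. *)
Lemma rank_le_card_approx (U : Type) (C : set U) L :
  is_subgroup L -> finite_set C ->
  (forall W, (forall w, w \in W -> ~ L w) -> exists H,
    [/\ is_subgroup H, L `<=` H, rank_le_card H C &
        forall w, w \in W -> ~ H w]) ->
  rank_le_card L C.
Proof.
move=> Lsub [n Cn] approx.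
have [T T_tr] := schreier_transversal_exists Lsub.
have [Tsuf Tsep _] := T_tr.
exists (schreier_gens L T); first exact: schreier_basis.
apply: contrapT => BC.
have [W WB Wn] : exists2 W : {fset F},
    [set` W] `<=` schreier_gens L T & (n < #|` W|)%N.
  have [[m Bm]|Binf] := pselect (finite_set (schreier_gens L T)); last first.
    exact: infinite_set_fset.
  have Bfin : finite_set (schreier_gens L T) by exists m.
  exists (fset_set (schreier_gens L T)); first by rewrite fset_setK.
  rewrite (card_fset_set Bm) ltnNge; apply/negP => mn; apply: BC.
  by rewrite (card_le_eql Bm) (card_le_eqr Cn) card_le_II.
have [V [VT V1 Vsuf WV]] := schreier_gens_finite (transversal1 T_tr) Tsuf WB.
(* Avoiding these elements keeps the cosets of the elements of [V] distinct.
   *)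
pose tests := [seq w <- [seq (t^-1 * u)%g | t <- V, u <- V] | `[< ~ L w >]].
have [|H [Hsub LH HC HV]] := approx tests.
  by move=> w; rewrite mem_filter => /andP[/asboolP].
have Vsep : separated H [set` V].
  move=> t u Vt Vu Htu; have [Ltu|Ltu] := pselect (L (t^-1 * u)%g).
    by apply: Tsep Ltu; exact: VT.
  case: (HV (t^-1 * u)%g) => //; rewrite mem_filter asboolT//=.
  by apply/allpairsP; exists (t, u).
have [T' T'_tr VT'] := schreier_transversal_ext Hsub V1 Vsuf Vsep.
have [B'_inj B'_range] := schreier_basis Hsub T'_tr.
have WB' : [set` W] `<=` schreier_gens H T'.
  move=> b /WV[Lb b1 [x [t [u [Vt Vu be]]]]]; split=> //; first exact: LH.
  by exists x, t, u; split=> //; exact: VT'.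
have [Y [phi [phi_inj phi_range YC]]] := rank_le_cardP HC.
have WC : ([set` W] #<= `I_n)%card.
  rewrite -(card_le_eqr Cn); apply: card_le_trans YC.
  apply: card_le_trans (subset_card_le WB') _.
  rewrite -(card_le_eql (card_setT _)).
  pose B' := schreier_gens H T'.
  apply: (card_basis_le (phi := phi) (psi := flift (val : B' -> F))) => //.
  by rewrite B'_range.
have := geq_card_fset_set WC.
by rewrite set_fsetK leqNgt Wn.
Qed.

(** A basis of [L] consists of elements of [K], and [K] has no more elements
    than [C]. *)
Lemma rank_le_card_infinite (C K L : set F) :
  is_basis K C -> infinite_set C -> is_subgroup L -> L `<=` K ->
  rank_le_card L C.
Proof.
move=> [C_inj CK] Cinf Lsub LK; have [B LB] := subgroup_basis Lsub.
exists B => //; have CT : ([set: C] #= C)%card := card_setT C.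
apply: card_le_trans (_ : (B #<= K)%card) _.
  apply: subset_card_le => b Bb; apply: LK; rewrite -LB.2.
  by exists (fgen (exist _ b (mem_set Bb))) => //; rewrite flift_gen.
rewrite -(card_le_eqr CT) -CK; apply: card_le_trans (card_image_le _ _) _.
apply: card_free_group_le; apply: contra_not Cinf => -[n Cn].
by exists n; rewrite -(card_eql CT).
Qed.

End Approximation.

(** * Equalisers *)

Section Inertia.
Variables (Sigma Delta : choiceType).
Local Notation F := (free_group Sigma).
Variables (S : set (ghom F (free_group Delta))) (h : ghom F (free_group Delta)).
Hypothesis Sh : S h.
Hypothesis equaliser_rank : forall (X : choiceType) (phi : ghom (free_group X) F)
    (g : ghom F (free_group Delta)),
  S g -> injective phi ->
  rank_le_card (equaliser (g \o phi) (h \o phi)) [set: X].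

(** Pulled back to a free group along a parametrisation of [H], the
    intersection becomes the equaliser of two restrictions. *)
Lemma rank_le_cardI_equaliser (U : Type) (C : set U) (H : set F) g :
  S g -> rank_le_card H C -> rank_le_card (H `&` equaliser g h) C.
Proof.
move=> Sg /rank_le_cardP[X [phi [phi_inj <- XC]]].
have [Y [psi [psi_inj psi_range YX]]] :=
  rank_le_cardP (equaliser_rank Sg phi_inj).
have -> : range phi `&` equaliser g h = range (phi \o psi).
  apply/seteqP; split=> [_ [[w _ <-] gh]|_ [v _ <-]].
    have : equaliser (g \o phi) (h \o phi) w by [].
    by rewrite -psi_range => -[v _ <-]; exists v.
  split; first by exists (psi v).
  have : range psi (psi v) by exists v.
  by rewrite psi_range.
apply: rank_le_card_range; first exact: inj_comp.
exact: card_le_trans YX XC.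
Qed.

Lemma inert_equaliser_of : inert (equaliser_of S).
Proof.
have eqSP x : equaliser_of S x <-> forall g, S g -> g x = h x.
  split=> [e g Sg|e g Sg g' Sg']; first exact: e.
  by rewrite /equaliser /= !e.
have eqS_subgroup : is_subgroup (equaliser_of S).
  apply/is_subgroupP; split; first by apply/eqSP => g _; rewrite !gmulf1.
  split=> [x y /eqSP ex /eqSP ey|x /eqSP ex]; apply/eqSP => g Sg.
    by rewrite !gmulfM (ex g Sg) (ey g Sg).
  by rewrite !gmulfV (ex g Sg).
split=> // K Ksub; have [C KC] := subgroup_basis Ksub; exists C => //.
have Lsub := is_subgroupI eqS_subgroup Ksub.
have [Cfin|Cinf] := pselect (finite_set C); last first.
  by apply: rank_le_card_infinite KC Cinf Lsub _ => x [].
apply: rank_le_card_approx => // W WL.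
suff [H [? ? ? _ ?]] : exists H, [/\ is_subgroup H, equaliser_of S `&` K `<=` H,
    rank_le_card H C, H `<=` K & forall w, w \in W -> ~ H w] by exists H.
(* Each element to be avoided costs at most one more equation. *)
elim: W WL => [_|w W IH WL].
  by exists K; split=> //; exists C.
have [|H [Hsub LH HC HK HW]] := IH.
  by move=> v vW; apply: WL; rewrite inE vW orbT.
have [Hw|Hw] := pselect (H w); last first.
  by exists H; split=> // v; rewrite inE => /orP[/eqP->|/HW].
have [g Sg gw] : exists2 g, S g & g w <> h w.
  apply: contrapT => Ng; apply: (WL w); first by rewrite inE eqxx.
  split; last exact: HK.
  by apply/eqSP => g Sg; apply: contrapT => gw; apply: Ng; exists g.
exists (H `&` equaliser g h); split.
- exact: is_subgroupI (is_subgroup_equaliser g h).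
- by move=> x Lx; split; [exact: LH|case: Lx => /eqSP + _; apply].
- exact: rank_le_cardI_equaliser.
- by move=> x [/HK].
- by move=> v; rewrite inE => /orP[/eqP->|/HW Hv] [].
Qed.

End Inertia.

(** The whole group has rank [Sigma], so inertia is tested on it. *)
Lemma rank_le_of_inert (Sigma : choiceType) (H : set (free_group Sigma)) :
  inert H -> rank_le_card H [set: Sigma].
Proof.
move=> [_ /(_ setT)[]]; first by apply/is_subgroupP.
move=> C [C_inj CT]; rewrite setIT => -[B HB BC]; exists B => //.
apply: card_le_trans BC _; rewrite -(card_le_eql (card_setT C)).
apply: (card_basis_le (phi := (idfun : ghom _ _))
  (psi := flift (val : C -> free_group Sigma))) => //.
by rewrite CT; apply/seteqP; split=> // x _; exists x.
Qed.

Theorem corollaryA2 :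
  ((forall (Sigma Delta : choiceType)
       (g h : ghom (free_group Sigma) (free_group Delta)),
     injective h -> rank_le_card (equaliser g h) [set: Sigma])
   <->
   (forall (Sigma Delta : choiceType)
       (S : set (ghom (free_group Sigma) (free_group Delta))),
     (exists2 h, S h & injective h) -> inert (equaliser_of S)))
  /\
  ((forall (Sigma Delta : choiceType)
       (g h : ghom (free_group Sigma) (free_group Delta)),
     injective g -> injective h -> rank_le_card (equaliser g h) [set: Sigma])
   <->
   (forall (Sigma Delta : choiceType)
       (S : set (ghom (free_group Sigma) (free_group Delta))),
     S !=set0 -> (forall h, S h -> injective h) -> inert (equaliser_of S))).
Proof.
have equaliser_pair (Sigma Delta : choiceType)
    (g h : ghom (free_group Sigma) (free_group Delta)) :
    equaliser_of [set g; h] = equaliser g h.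
  apply/seteqP; split=> [x e|x e _ [->|->] _ [->|->]]//.
  by apply: e; [left|right].
split; split=> rank_eq Sigma Delta.
- move=> S [h Sh h_inj]; apply: (@inert_equaliser_of _ _ S h) => //.
  by move=> X phi g _ phi_inj; apply: rank_eq; exact: inj_comp.
- move=> g h h_inj; rewrite -equaliser_pair; apply: rank_le_of_inert.
  by apply: rank_eq; exists h => //; right.
- move=> S [h Sh] S_inj; apply: (@inert_equaliser_of _ _ S h) => //.
  move=> X phi g Sg phi_inj.
  by apply: rank_eq; apply: inj_comp => //; exact: S_inj.
- move=> g h g_inj h_inj; rewrite -equaliser_pair; apply: rank_le_of_inert.
  by apply: rank_eq; [exists g; left|move=> _ [->|->]].
Qed.
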